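(* Let $\mathcal{Q}$ be a small quantaloid and $\mathcal{T}:\mathcal{Q}\text{-}\mathbf{Cat}\to\mathcal{Q}\text{-}\mathbf{Cat}$ a 2-functor. Any flat lax extension of $\mathcal{T}$ to $\mathcal{Q}\text{-}\mathbf{Dist}$ must equal $\overline{\mathcal{T}}$.
   Context: A quantaloid $\mathcal{Q}$ is a category whose hom-sets are complete lattices such that composition preserves arbitrary suprema in each variable; $\mathcal{Q}_0=\mathrm{ob}\,\mathcal{Q}$. For $\alpha:p\to q,\beta:q\to r,\gamma:p\to r$: $\alpha\le\beta\searrow\gamma\iff\beta\circ\alpha\le\gamma\iff\beta\le\gamma\swarrow\alpha$; the same notation is used in $\mathcal{Q}\text{-}\mathbf{Dist}$ below. A $\mathcal{Q}$-relation $r:X\nrightarrow Y$ between sets over $\mathcal{Q}_0$ (sets with a type map $|\cdot|$ to $\mathcal{Q}_0$) is a family of morphisms $r(x,y):|x|\to|y|$ in $\mathcal{Q}$; $(s\circ r)(x,z)=\bigvee_y s(y,z)\circ r(x,y)$; the identity is $1_X^\circ$ with $1_X^\circ(x,x)=1_{|x|}$ and $1_X^\circ(x,y)=\bot$ for $x\ne y$; order pointwise. A $\mathcal{Q}$-category is $(X,a)$ with $a:X\nrightarrow X$, $1_X^\circ\le a$, $a\circ a\le a$. A $\mathcal{Q}$-functor $f:(X,a)\to(Y,b)$ is a type-preserving map with $a(x,x')\le b(fx,fx')$; $f\le g$ iff $1_{|x|}\le b(fx,gx)$ for all $x$. This gives the 2-category $\mathcal{Q}\text{-}\mathbf{Cat}$;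 a 2-functor on it is a functor monotone on homs. A $\mathcal{Q}$-distributor $\varphi:(X,a)\nrightarrow(Y,b)$ is a $\mathcal{Q}$-relation with $b\circ\varphi\circ a\le\varphi$; these form the quantaloid $\mathcal{Q}\text{-}\mathbf{Dist}$ with composition and order as for $\mathcal{Q}$-relations and identity $1^*_{(X,a)}=a$. For a $\mathcal{Q}$-functor $f:(X,a)\to(Y,b)$: $f_*:X\nrightarrow Y$, $f_*(x,y)=b(fx,y)$, and $f^*:Y\nrightarrow X$, $f^*(y,x)=b(y,fx)$. $\mathcal{P}X$ is the $\mathcal{Q}$-category of distributors $\sigma:X\nrightarrow\{s\}$, $s\in\mathcal{Q}_0$ ($\{s\}$ is the one-object $\mathcal{Q}$-category of type $s$ with hom $1_s$), with $|\sigma|=s$ and hom $1^*_{\mathcal{P}X}(\sigma,\tau)=\tau\swarrow\sigma$. The Yoneda functor is $\mathsf{y}_X:X\to\mathcal{P}X$, $x\mapsto a(-,x)$. For a distributor $\varphi:X\nrightarrow Y$, $\overleftarrow{\varphi}:Y\to\mathcal{P}X$ is the $\mathcal{Q}$-functor $y\mapsto\varphi(-,y)$. A lax extension of $\mathcal{T}$ to $\mathcal{Q}\text{-}\mathbf{Dist}$ is a lax 2-functor $\hat{\mathcal{T}}:\mathcal{Q}\text{-}\mathbf{Dist}\to\mathcal{Q}\text{-}\mathbf{Dist}$ (monotone on homs, $1^*_{\hat{\mathcal{T}}X}\le\hat{\mathcal{T}}1_X^*$, $\hat{\mathcal{T}}\psi\circ\hat{\mathcal{T}}\varphi\le\hat{\mathcal{T}}(\psi\circ\varphi)$)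 agreeing with $\mathcal{T}$ on objects with $(\mathcal{T}f)_*\le\hat{\mathcal{T}}(f_* )$ and $(\mathcal{T}f)^*\le\hat{\mathcal{T}}(f^* )$ for all $\mathcal{Q}$-functors $f$; it is flat if these two inequalities are always equalities. Finally, $\overline{\mathcal{T}}X=\mathcal{T}X$ and $\overline{\mathcal{T}}\varphi:=(\mathcal{T}\overleftarrow{\varphi})^*\circ(\mathcal{T}\mathsf{y}_X)_*$ for every distributor $\varphi:X\nrightarrow Y$. *)

(* Defs.v *)
From Stdlib Require Import ssreflect Relation_Definitions.

Set Implicit Arguments.
Unset Strict Implicit.
Unset Printing Implicit Defensive.

Declare Scope qtld_scope.
Delimit Scope qtld_scope with Q.
Local Open Scope qtld_scope.

(* Smallness: the object type, the hom types and the carriers of Q-categories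
   all live in [Type], with the presheaf Q-category of a Q-category again a
   Q-category in the same universe.  Composition is written in the order of
   function composition. *)
Record quantaloid := Quantaloid {
  qob :> Type;
  qhom : qob -> qob -> Type;
  qid : forall p, qhom p p;
  qcomp : forall p q r, qhom q r -> qhom p q -> qhom p r;
  qle : forall p q, relation (qhom p q);
  qsup : forall p q, (qhom p q -> Prop) -> qhom p q;
  qcompA : forall p q r s (w : qhom r s) (v : qhom q r) (u : qhom p q),
    qcomp w (qcomp v u) = qcomp (qcomp w v) u;
  qcomp1l : forall p q (u : qhom p q), qcomp (qid q) u = u;
  qcomp1r : forall p q (u : qhom p q), qcomp u (qid p) = u;
  qle_order : forall p q, order (qhom p q) (@qle p q);
  qsup_ub : forall p q (S : qhom p q -> Prop) u, S u -> qle u (qsup S);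
  qsup_least : forall p q (S : qhom p q -> Prop) w,
    (forall u, S u -> qle u w) -> qle (qsup S) w;
  qcomp_supl : forall p q r (S : qhom q r -> Prop) (u : qhom p q),
    qcomp (qsup S) u = qsup (fun w => exists2 v, S v & w = qcomp v u);
  qcomp_supr : forall p q r (v : qhom q r) (S : qhom p q -> Prop),
    qcomp v (qsup S) = qsup (fun w => exists2 u, S u & w = qcomp v u)
}.

Arguments qhom {q} _ _ : rename.
Arguments qid {q} p : rename.

Infix "≤" := qle (at level 70, no associativity) : qtld_scope.
Infix "∘" := qcomp (at level 40, left associativity) : qtld_scope.

Section Homs.
Variable Q : quantaloid.

Lemma qle_refl (p q : Q) (u : qhom p q) : u ≤ u.
Proof. exact: ord_refl _ _ (qle_order p q) u. Qed.

Lemma qle_trans (p q : Q) (v u w : qhom p q) : u ≤ v -> v ≤ w -> u ≤ w.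
Proof. exact: ord_trans _ _ (qle_order p q) u v w. Qed.

Lemma qle_antisym (p q : Q) (u v : qhom p q) : u ≤ v -> v ≤ u -> u = v.
Proof. exact: ord_antisym _ _ (qle_order p q) u v. Qed.

Lemma qcomp_monol (p q r : Q) (v v' : qhom q r) (u : qhom p q) :
  v ≤ v' -> v ∘ u ≤ v' ∘ u.
Proof.
move=> le_v.
have -> : v' = qsup (fun w => w = v \/ w = v').
  apply: qle_antisym; first by apply: qsup_ub; right.
  by apply: qsup_least => w [->|->] //; apply: qle_refl.
by rewrite qcomp_supl; apply: qsup_ub; exists v => //; left.
Qed.

Lemma qcomp_monor (p q r : Q) (v : qhom q r) (u u' : qhom p q) :
  u ≤ u' -> v ∘ u ≤ v ∘ u'.
Proof.
move=> le_u.
have -> : u' = qsup (fun w => w = u \/ w = u').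
  apply: qle_antisym; first by apply: qsup_ub; right.
  by apply: qsup_least => w [->|->] //; apply: qle_refl.
by rewrite qcomp_supr; apply: qsup_ub; exists u => //; left.
Qed.

Lemma qcomp_mono (p q r : Q) (v v' : qhom q r) (u u' : qhom p q) :
  v ≤ v' -> u ≤ u' -> v ∘ u ≤ v' ∘ u'.
Proof.
by move=> le_v le_u; apply: qle_trans (qcomp_monol _ le_v) (qcomp_monor _ le_u).
Qed.

(* A type-preserving map only has |f x| = |x| as a propositional equality, so
   morphisms between |f x| and |f x'| are transported along it. *)
Definition qcast (p p' q q' : Q) (ep : p = p') (eq : q = q') (u : qhom p q) :
    qhom p' q' :=
  match ep in _ = p1, eq in _ = q1 return qhom p1 q1 with
  | eq_refl, eq_refl => u
  end.

Lemma qcast_mono (p p' q q' : Q) (ep : p = p') (eq : q = q') (u v : qhom p q) :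
  u ≤ v -> qcast ep eq u ≤ qcast ep eq v.
Proof. by case: _ / ep; case: _ / eq. Qed.

Lemma qcast_comp (p p' q q' r r' : Q) (ep : p = p') (eq : q = q') (er : r = r')
    (v : qhom q r) (u : qhom p q) :
  qcast eq er v ∘ qcast ep eq u = qcast ep er (v ∘ u).
Proof. by case: _ / ep; case: _ / eq; case: _ / er. Qed.

Lemma qcast_trans (p p' p'' q q' q'' : Q) (ep : p = p') (ep' : p' = p'')
    (eq : q = q') (eq' : q' = q'') (u : qhom p q) :
  qcast ep' eq' (qcast ep eq u) = qcast (eq_trans ep ep') (eq_trans eq eq') u.
Proof. by case: _ / ep'; case: _ / eq'. Qed.

End Homs.

Section Relations.
Variable Q : quantaloid.

Record qset := QSet { qcar :> Type; qtype : qcar -> Q }.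

Definition qrel (X Y : qset) := forall (x : X) (y : Y), qhom (qtype x) (qtype y).

Definition rel_le (X Y : qset) (r s : qrel X Y) := forall x y, r x y ≤ s x y.

Definition rel_comp (X Y Z : qset) (s : qrel Y Z) (r : qrel X Y) : qrel X Z :=
  fun x z => qsup (fun w => exists y, w = s y z ∘ r x y).

(* The supremum ranges over at most one morphism: the identity of |x| if
   x = x', and nothing (so that its value is bottom) otherwise. *)
Definition rel_id (X : qset) : qrel X X := fun x x' =>
  qsup (fun w => exists e : x = x', w = qcast eq_refl (f_equal (@qtype X) e) (qid _)).

Arguments rel_id X : clear implicits.

Lemma rel_le_refl (X Y : qset) (r : qrel X Y) : rel_le r r.
Proof. by move=> x y; apply: qle_refl. Qed.

Lemma rel_le_trans (X Y : qset) (s r t : qrel X Y) :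
  rel_le r s -> rel_le s t -> rel_le r t.
Proof. by move=> le_rs le_st x y; apply: qle_trans (le_st x y). Qed.

Lemma rel_id_leP (X : qset) (a : qrel X X) :
  rel_le (rel_id X) a <-> forall x, qid (qtype x) ≤ a x x.
Proof.
split=> [le_a x|le_a x x'].
  by apply: qle_trans (le_a x x); apply: qsup_ub; exists eq_refl.
by apply: qsup_least => w [e ->]; case: _ / e; apply: le_a.
Qed.

Lemma rel_comp_leP (X Y Z : qset) (s : qrel Y Z) (r : qrel X Y) (t : qrel X Z) :
  rel_le (rel_comp s r) t <-> forall x y z, s y z ∘ r x y ≤ t x z.
Proof.
split=> [le_t x y z|le_t x z].
  by apply: qle_trans (le_t x z); apply: qsup_ub; exists y.
by apply: qsup_least => w [y ->].
Qed.

Lemma rel_comp_mono (X Y Z : qset) (s s' : qrel Y Z) (r r' : qrel X Y) :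
  rel_le s s' -> rel_le r r' -> rel_le (rel_comp s r) (rel_comp s' r').
Proof.
move=> le_s le_r; apply/rel_comp_leP => x y z.
by apply: qle_trans (qcomp_mono (le_s y z) (le_r x y)) _; apply: qsup_ub; exists y.
Qed.

End Relations.

Arguments rel_id {Q} X.

Section Categories.
Variable Q : quantaloid.

Record qcat := QCat {
  qcat_set :> qset Q;
  chom : qrel qcat_set qcat_set;
  chom_unit : rel_le (rel_id qcat_set) chom;
  chom_comp : rel_le (rel_comp chom chom) chom
}.

Lemma chom_id (X : qcat) (x : X) : qid (qtype x) ≤ chom x x.
Proof. exact: (proj1 (rel_id_leP _) (chom_unit (q := X))). Qed.

Lemma chom_trans (X : qcat) (x y z : X) : chom y z ∘ chom x y ≤ chom x z.
Proof. exact: (proj1 (rel_comp_leP _ _ _) (chom_comp (q := X))). Qed.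

Record qfunctor (X Y : qcat) := QFunctor {
  fmap :> X -> Y;
  fmap_type : forall x, qtype (fmap x) = qtype x;
  fmap_hom : forall x x',
    chom x x' ≤ qcast (fmap_type x) (fmap_type x') (chom (fmap x) (fmap x'))
}.

Definition qfunctor_le (X Y : qcat) (f g : qfunctor X Y) := forall x,
  qid (qtype x) ≤ qcast (fmap_type f x) (fmap_type g x) (chom (f x) (g x)).

Lemma qfunctor_id_hom (X : qcat) (x x' : X) :
  chom x x' ≤ qcast eq_refl eq_refl (chom x x').
Proof. exact: qle_refl. Qed.

Definition qfunctor_id (X : qcat) : qfunctor X X :=
  QFunctor (fmap := fun x => x) (@qfunctor_id_hom X).

Lemma qfunctor_comp_hom (X Y Z : qcat) (g : qfunctor Y Z) (f : qfunctor X Y)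
    (x x' : X) :
  chom x x' ≤ qcast (eq_trans (fmap_type g (f x)) (fmap_type f x))
                    (eq_trans (fmap_type g (f x')) (fmap_type f x'))
                    (chom (g (f x)) (g (f x'))).
Proof.
apply: qle_trans (fmap_hom f x x') _; rewrite -qcast_trans.
by apply: qcast_mono; apply: fmap_hom.
Qed.

Definition qfunctor_comp (X Y Z : qcat) (g : qfunctor Y Z) (f : qfunctor X Y) :
    qfunctor X Z :=
  QFunctor (fmap := fun x => g (f x)) (@qfunctor_comp_hom X Y Z g f).

Definition one_set (s : Q) : qset Q := QSet (fun _ : unit => s).

Definition one_rel (s : Q) : qrel (one_set s) (one_set s) := fun _ _ => qid s.

Arguments one_rel s : clear implicits.

Lemma one_unit (s : Q) : rel_le (rel_id (one_set s)) (one_rel s).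
Proof. by apply/rel_id_leP => x; apply: qle_refl. Qed.

Lemma one_comp (s : Q) : rel_le (rel_comp (one_rel s) (one_rel s)) (one_rel s).
Proof.
by apply/rel_comp_leP => x y z; rewrite /one_rel qcomp1l; apply: qle_refl.
Qed.

Definition one_cat (s : Q) : qcat := QCat (@one_unit s) (@one_comp s).

End Categories.

Arguments qfunctor_id {Q} X.
Arguments one_cat {Q} s.

Section Distributors.
Variable Q : quantaloid.

Record qdist (X Y : qcat Q) := QDist {
  dist_rel :> forall (x : X) (y : Y), qhom (qtype x) (qtype y);
  dist_axiom : rel_le (rel_comp (rel_comp (chom (q := Y)) dist_rel) (chom (q := X)))
                      dist_rel
}.

Definition dist_le (X Y : qcat Q) (phi psi : qdist X Y) := rel_le phi psi.

Lemma dist_axiomP (X Y : qcat Q) (r : qrel X Y) :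
  rel_le (rel_comp (rel_comp (chom (q := Y)) r) (chom (q := X))) r <->
  (forall x' x y y', chom y y' ∘ r x y ∘ chom x' x ≤ r x' y').
Proof.
split=> [le_r x' x y y'|le_r].
  apply: qle_trans (proj1 (rel_comp_leP _ _ _) le_r x' x y').
  by apply: qcomp_monol; apply: qsup_ub; exists y.
apply/rel_comp_leP => x' x y'; rewrite qcomp_supl.
by apply: qsup_least => w [v [y ->] ->].
Qed.

Lemma dist_actl (X Y : qcat Q) (phi : qdist X Y) (x : X) (y y' : Y) :
  chom y y' ∘ phi x y ≤ phi x y'.
Proof.
apply: qle_trans (proj1 (dist_axiomP _) (dist_axiom phi) x x y y').
by rewrite -{1}[_ ∘ _]qcomp1r; apply: qcomp_monor; apply: chom_id.
Qed.

Lemma dist_actr (X Y : qcat Q) (phi : qdist X Y) (x' x : X) (y : Y) :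
  phi x y ∘ chom x' x ≤ phi x' y.
Proof.
apply: qle_trans (proj1 (dist_axiomP _) (dist_axiom phi) x' x y y).
apply: qcomp_monol; rewrite -{1}[phi x y]qcomp1l.
by apply: qcomp_monol; apply: chom_id.
Qed.

Lemma dist_axiom_intro (X Y : qcat Q) (r : qrel X Y) :
  (forall x y y', chom y y' ∘ r x y ≤ r x y') ->
  (forall x' x y, r x y ∘ chom x' x ≤ r x' y) ->
  rel_le (rel_comp (rel_comp (chom (q := Y)) r) (chom (q := X))) r.
Proof.
move=> actl actr; apply/dist_axiomP => x' x y y'.
exact: qle_trans (qcomp_monol _ (actl _ _ _)) (actr _ _ _).
Qed.

Lemma dist_id_axiom (X : qcat Q) :
  rel_le (rel_comp (rel_comp (chom (q := X)) (chom (q := X))) (chom (q := X)))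
         (chom (q := X)).
Proof. by apply: dist_axiom_intro => x y z; apply: chom_trans. Qed.

Definition dist_id (X : qcat Q) : qdist X X := QDist (@dist_id_axiom X).

Lemma dist_comp_axiom (X Y Z : qcat Q) (psi : qdist Y Z) (phi : qdist X Y) :
  rel_le (rel_comp (rel_comp (chom (q := Z)) (rel_comp psi phi)) (chom (q := X)))
         (rel_comp psi phi).
Proof.
apply: dist_axiom_intro => [x z z'|x' x z].
  rewrite qcomp_supr; apply: qsup_least => w [u [y ->] ->]; rewrite qcompA.
  apply: qle_trans (qcomp_monol _ (dist_actl _ _ _ _)) _.
  by apply: qsup_ub; exists y.
rewrite qcomp_supl; apply: qsup_least => w [u [y ->] ->]; rewrite -qcompA.
apply: qle_trans (qcomp_monor _ (dist_actr _ _ _ _)) _.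
by apply: qsup_ub; exists y.
Qed.

Definition dist_comp (X Y Z : qcat Q) (psi : qdist Y Z) (phi : qdist X Y) :
    qdist X Z :=
  QDist (@dist_comp_axiom X Y Z psi phi).

Lemma dist_sup_axiom (X Y : qcat Q) (S : qdist X Y -> Prop) :
  let r : qrel X Y := fun x y =>
    qsup (fun w => exists2 phi : qdist X Y, S phi & w = phi x y) in
  rel_le (rel_comp (rel_comp (chom (q := Y)) r) (chom (q := X))) r.
Proof.
apply: dist_axiom_intro => [x y y'|x' x y].
  rewrite qcomp_supr; apply: qsup_least => w [u [phi Sphi ->] ->].
  by apply: qle_trans (dist_actl _ _ _ _) _; apply: qsup_ub; exists phi.
rewrite qcomp_supl; apply: qsup_least => w [u [phi Sphi ->] ->].
by apply: qle_trans (dist_actr _ _ _ _) _; apply: qsup_ub; exists phi.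
Qed.

Definition dist_sup (X Y : qcat Q) (S : qdist X Y -> Prop) : qdist X Y :=
  QDist (@dist_sup_axiom X Y S).

(* The residual psi ↙ phi of the quantaloid Q-Dist, i.e. the largest chi with
   chi ∘ phi ≤ psi. *)
Definition dist_resl (X Y Z : qcat Q) (psi : qdist X Z) (phi : qdist X Y) :
    qdist Y Z :=
  dist_sup (fun chi => dist_le (dist_comp chi phi) psi).

Lemma dist_reslP (X Y Z : qcat Q) (chi : qdist Y Z) (phi : qdist X Y)
    (psi : qdist X Z) :
  dist_le (dist_comp chi phi) psi <-> dist_le chi (dist_resl psi phi).
Proof.
split=> [le_psi y z|le_chi]; first by apply: qsup_ub; exists chi.
apply: (@rel_le_trans _ _ _ (rel_comp (dist_resl psi phi) phi)).
  exact: rel_comp_mono le_chi (@rel_le_refl _ _ _ _).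
apply/rel_comp_leP => x y z; rewrite qcomp_supl.
apply: qsup_least => w [u [chi' le_psi ->] ->].
exact: (proj1 (rel_comp_leP _ _ _) le_psi).
Qed.

Section Graphs.
Variables (X Y : qcat Q) (f : qfunctor X Y).

Definition lower_rel : qrel X Y := fun x y =>
  qcast (fmap_type f x) eq_refl (chom (f x) y).

Definition upper_rel : qrel Y X := fun y x =>
  qcast eq_refl (fmap_type f x) (chom y (f x)).

Lemma lower_axiom :
  rel_le (rel_comp (rel_comp (chom (q := Y)) lower_rel) (chom (q := X))) lower_rel.
Proof.
apply: dist_axiom_intro => [x y y'|x' x y].
  rewrite -[chom y y']/(qcast eq_refl eq_refl (chom y y')) qcast_comp.
  by apply: qcast_mono; apply: chom_trans.
apply: qle_trans (qcomp_monor _ (fmap_hom f x' x)) _; rewrite qcast_comp.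
by apply: qcast_mono; apply: chom_trans.
Qed.

Lemma upper_axiom :
  rel_le (rel_comp (rel_comp (chom (q := X)) upper_rel) (chom (q := Y))) upper_rel.
Proof.
apply: dist_axiom_intro => [y x x'|y' y x].
  apply: qle_trans (qcomp_monol _ (fmap_hom f x x')) _; rewrite qcast_comp.
  by apply: qcast_mono; apply: chom_trans.
rewrite -[chom y' y]/(qcast eq_refl eq_refl (chom y' y)) qcast_comp.
by apply: qcast_mono; apply: chom_trans.
Qed.

Definition lower_star : qdist X Y := QDist lower_axiom.
Definition upper_star : qdist Y X := QDist upper_axiom.

End Graphs.

End Distributors.

Arguments dist_id {Q} X.

Section Presheaves.
Variable Q : quantaloid.
Implicit Types X Y : qcat Q.

Record presheaf X := Presheaf {
  psh_type : Q;
  psh_dist :> qdist X (one_cat psh_type)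
}.

Definition presheaf_set X : qset Q := QSet (@psh_type X).

(* The hom is tau ↙ sigma : {s} -> {t}, a distributor between one-object
   Q-categories, read as its single component s -> t in Q. *)
Definition presheaf_hom X : qrel (presheaf_set X) (presheaf_set X) :=
  fun sigma tau => dist_resl (psh_dist tau) (psh_dist sigma) tt tt.

Lemma one_dist_axiom (s t : Q) (u : qhom s t) :
  let r : qrel (one_cat s) (one_cat t) := fun _ _ => u in
  rel_le (rel_comp (rel_comp (chom (q := one_cat t)) r) (chom (q := one_cat s))) r.
Proof.
by apply: dist_axiom_intro => * /=; rewrite ?qcomp1l ?qcomp1r; apply: qle_refl.
Qed.

Definition one_dist (s t : Q) (u : qhom s t) : qdist (one_cat s) (one_cat t) :=
  QDist (@one_dist_axiom s t u).

Lemma presheaf_homP X (sigma tau : presheaf_set X)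
    (u : qhom (qtype sigma) (qtype tau)) :
  u ≤ presheaf_hom sigma tau <->
  (forall x, u ∘ psh_dist sigma x tt ≤ psh_dist tau x tt).
Proof.
have := dist_reslP (one_dist u) (psh_dist sigma) (psh_dist tau).
case=> to_resl of_resl; split=> [le_u x|le_u].
  have le_res: dist_le (one_dist u) (dist_resl (psh_dist tau) (psh_dist sigma)).
    by case=> [] [].
  exact: (proj1 (rel_comp_leP _ _ _) (of_resl le_res) x tt tt).
apply: (to_resl _ tt tt); apply/rel_comp_leP => x [] []; exact: le_u.
Qed.

Lemma presheaf_unit X : rel_le (rel_id (presheaf_set X)) (@presheaf_hom X).
Proof.
apply/rel_id_leP => sigma; apply/presheaf_homP => x.
by rewrite qcomp1l; apply: qle_refl.
Qed.

Lemma presheaf_comp X :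
  rel_le (rel_comp (@presheaf_hom X) (@presheaf_hom X)) (@presheaf_hom X).
Proof.
apply/rel_comp_leP => rho sigma tau; apply/presheaf_homP => x.
rewrite -qcompA.
have le1 := proj1 (presheaf_homP (presheaf_hom rho sigma)) (qle_refl _) x.
apply: qle_trans (qcomp_monor _ le1) _.
exact: (proj1 (presheaf_homP (presheaf_hom sigma tau)) (qle_refl _) x).
Qed.

Definition presheaf_cat X : qcat Q := QCat (@presheaf_unit X) (@presheaf_comp X).

Section Transpose.
Variables (X Y : qcat Q) (phi : qdist X Y).

Lemma column_axiom (y : Y) :
  let r : qrel X (one_cat (qtype y)) := fun x _ => phi x y in
  rel_le (rel_comp (rel_comp (chom (q := one_cat (qtype y))) r) (chom (q := X))) r.
Proof.
apply: dist_axiom_intro => [x [] []|x' x []] /=.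
  by rewrite qcomp1l; apply: qle_refl.
exact: dist_actr.
Qed.

Definition column (y : Y) : presheaf_cat X := Presheaf (QDist (@column_axiom y)).

Lemma transpose_hom (y y' : Y) :
  chom y y' ≤ qcast eq_refl eq_refl (chom (column y) (column y')).
Proof.
by apply: (proj2 (@presheaf_homP X (column y) (column y') _)) => x; apply: dist_actl.
Qed.

(* The functor y |-> phi(-,y), usually written phi with a left arrow on top. *)
Definition transpose : qfunctor Y (presheaf_cat X) :=
  QFunctor (fmap := column) transpose_hom.

End Transpose.

(* Sends x to the column a(-,x) of the hom relation a of X. *)
Definition yoneda X : qfunctor X (presheaf_cat X) := transpose (dist_id X).

End Presheaves.

Section Extensions.
Variable Q : quantaloid.

(* Equality of Q-functors is Leibniz equality, which by functional
   extensionality and proof irrelevance is equality of underlying maps. *)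
Record two_functor := TwoFunctor {
  tf_ob :> qcat Q -> qcat Q;
  tf_map : forall X Y, qfunctor X Y -> qfunctor (tf_ob X) (tf_ob Y);
  tf_id : forall X, tf_map (qfunctor_id X) = qfunctor_id (tf_ob X);
  tf_comp : forall X Y Z (g : qfunctor Y Z) (f : qfunctor X Y),
    tf_map (qfunctor_comp g f) = qfunctor_comp (tf_map g) (tf_map f);
  tf_mono : forall X Y (f g : qfunctor X Y),
    qfunctor_le f g -> qfunctor_le (tf_map f) (tf_map g)
}.

(* Agreement with T on objects is built into the type of [lax_map]. *)
Record lax_extension (T : two_functor) := LaxExtension {
  lax_map :> forall X Y, qdist X Y -> qdist (T X) (T Y);
  lax_mono : forall X Y (phi psi : qdist X Y),
    dist_le phi psi -> dist_le (lax_map phi) (lax_map psi);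
  lax_id : forall X, dist_le (dist_id (T X)) (lax_map (dist_id X));
  lax_comp : forall X Y Z (psi : qdist Y Z) (phi : qdist X Y),
    dist_le (dist_comp (lax_map psi) (lax_map phi)) (lax_map (dist_comp psi phi));
  lax_lower : forall X Y (f : qfunctor X Y),
    dist_le (lower_star (tf_map T f)) (lax_map (lower_star f));
  lax_upper : forall X Y (f : qfunctor X Y),
    dist_le (upper_star (tf_map T f)) (lax_map (upper_star f))
}.

Definition flat (T : two_functor) (That : lax_extension T) :=
  forall X Y (f : qfunctor X Y),
    lower_star (tf_map T f) = That _ _ (lower_star f) /\
    upper_star (tf_map T f) = That _ _ (upper_star f).

Definition Tbar (T : two_functor) (X Y : qcat Q) (phi : qdist X Y) :
    qdist (T X) (T Y) :=
  dist_comp (upper_star (tf_map T (transpose phi)))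
            (lower_star (tf_map T (yoneda X))).

End Extensions.

(* Main.v *)
(** Every distributor factors as [phi = f^* ∘ y_*] with [f] the transpose of
    [phi], so lax functoriality and flatness give [Tbar phi <= That phi].
    Conversely, [(T f)_*] is left adjoint to [(T f)^*] and [f_* ∘ phi <= y_*],
    whence
      [That phi <= (T f)^* ∘ (T f)_* ∘ That phi
                <= (T f)^* ∘ That (f_* ∘ phi)
                <= (T f)^* ∘ That y_* = Tbar phi]. *)

From Stdlib Require Import ssreflect FunctionalExtensionality ProofIrrelevance.
Require Import Defs.

Set Implicit Arguments.
Unset Strict Implicit.
Unset Printing Implicit Defensive.

Local Open Scope qtld_scope.

Section DistAlgebra.
Variable Q : quantaloid.
Implicit Types X Y Z W : qcat Q.

Lemma dist_le_trans X Y (psi phi chi : qdist X Y) :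
  dist_le phi psi -> dist_le psi chi -> dist_le phi chi.
Proof. exact: rel_le_trans. Qed.

(** Functional extensionality identifies the underlying relations and proof irrelevance the two
    axiom fields, so mutual inequality gives Leibniz equality. *)
Lemma dist_le_antisym X Y (phi psi : qdist X Y) :
  dist_le phi psi -> dist_le psi phi -> phi = psi.
Proof.
move=> le12 le21.
have eq_rel : dist_rel phi = dist_rel psi.
  by do 2!apply: functional_extensionality_dep => ?; apply: qle_antisym.
case: phi psi eq_rel {le12 le21} => [r ax] [s ax'] /= eq_rs.
by case: s / eq_rs ax' => ax'; rewrite (proof_irrelevance _ ax ax').
Qed.

Lemma dist_comp_mono X Y Z (psi psi' : qdist Y Z) (phi phi' : qdist X Y) :
  dist_le psi psi' -> dist_le phi phi' ->
  dist_le (dist_comp psi phi) (dist_comp psi' phi').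
Proof. exact: rel_comp_mono. Qed.

Lemma dist_comp_monol X Y Z (psi psi' : qdist Y Z) (phi : qdist X Y) :
  dist_le psi psi' -> dist_le (dist_comp psi phi) (dist_comp psi' phi).
Proof. by move=> le_psi; apply: dist_comp_mono le_psi (rel_le_refl _). Qed.

Lemma dist_comp_monor X Y Z (psi : qdist Y Z) (phi phi' : qdist X Y) :
  dist_le phi phi' -> dist_le (dist_comp psi phi) (dist_comp psi phi').
Proof. exact: dist_comp_mono (rel_le_refl _). Qed.

Lemma dist_compA X Y Z W (chi : qdist Z W) (psi : qdist Y Z) (phi : qdist X Y) :
  dist_comp chi (dist_comp psi phi) = dist_comp (dist_comp chi psi) phi.
Proof.
apply: dist_le_antisym; apply/rel_comp_leP; [move=> x z w|move=> x y w].
  rewrite qcomp_supr; apply: qsup_least => _ [_ [y ->] ->]; rewrite qcompA.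
  apply: (@qle_trans _ _ _ (dist_comp chi psi y w ∘ phi x y)).
    by apply: qcomp_monol; apply: qsup_ub; exists z.
  by apply: qsup_ub; exists y.
rewrite qcomp_supl; apply: qsup_least => _ [_ [z ->] ->]; rewrite -qcompA.
apply: (@qle_trans _ _ _ (chi z w ∘ dist_comp psi phi x z)).
  by apply: qcomp_monor; apply: qsup_ub; exists y.
by apply: qsup_ub; exists z.
Qed.

Lemma dist_comp1l X Y (phi : qdist X Y) : dist_comp (dist_id Y) phi = phi.
Proof.
apply: dist_le_antisym => [|x y].
  by apply/rel_comp_leP => x y z; apply: dist_actl.
apply: (@qle_trans _ _ _ (chom y y ∘ phi x y)); last by apply: qsup_ub; exists y.
by rewrite -{1}[phi x y]qcomp1l; apply: qcomp_monol; apply: chom_id.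
Qed.

(** Counit of the adjunction between [f_*] and [f^*]: the casts along the type equality at [f x]
    cancel, leaving transitivity through [f x]. *)
Lemma lower_upper_counit X Y (f : qfunctor X Y) :
  dist_le (dist_comp (lower_star f) (upper_star f)) (dist_id Y).
Proof.
by apply/rel_comp_leP => y x y'; rewrite qcast_comp; apply: chom_trans.
Qed.

Lemma lower_upper_unit X Y (f : qfunctor X Y) :
  dist_le (dist_id X) (dist_comp (upper_star f) (lower_star f)).
Proof.
(* At the index [f x'] the left factor dominates an identity. *)
move=> x x'; apply: (@qle_trans _ _ _ (upper_star f (f x') x' ∘ lower_star f x (f x'))).
  rewrite qcast_comp; apply: qle_trans (fmap_hom f x x') (qcast_mono _ _ _).
  by rewrite -{1}[chom (f x) (f x')]qcomp1l; apply: qcomp_monol; apply: chom_id.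
by apply: qsup_ub; exists (f x').
Qed.

(** The Yoneda lemma: composing homs through any presheaf [sigma] stays below the hom from
    [yoneda X x] to [phi(-,y)], which is [phi x y]. *)
Lemma dist_yoneda_factor X Y (phi : qdist X Y) :
  dist_comp (upper_star (transpose phi)) (lower_star (yoneda X)) = phi.
Proof.
apply: dist_le_antisym => [|x y].
  apply/rel_comp_leP => x sigma y.
  apply: qle_trans (chom_trans (yoneda X x) sigma (transpose phi y)) _.
  set u := chom _ _.
  (* Evaluating [u] at the identity of [x]: [chom x x] is the value at [x] of the presheaf
     [yoneda X x]. *)
  apply: (@qle_trans _ _ _ (u ∘ chom x x)).
    by rewrite -{1}[u]qcomp1r; apply: qcomp_monor; apply: chom_id.
  exact: (proj1 (@presheaf_homP _ X (yoneda X x) (transpose phi y) u) (qle_refl _) x).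
rewrite -{1}[phi x y]qcomp1l.
(* The supremum is attained at [sigma = phi(-,y)]. *)
apply: (@qle_trans _ _ _ (upper_star (transpose phi) (transpose phi y) y
                          ∘ lower_star (yoneda X) x (transpose phi y))).
  apply: qcomp_mono; first exact: (chom_id (transpose phi y)).
  apply: (proj2 (@presheaf_homP _ X (yoneda X x) (transpose phi y) _)) => x'.
  exact: dist_actr.
by apply: qsup_ub; exists (transpose phi y).
Qed.

(** Once [phi] is factored as [f^* ∘ y_*], the counit absorbs [f_* ∘ f^*]. *)
Lemma transpose_lower_le X Y (phi : qdist X Y) :
  dist_le (dist_comp (lower_star (transpose phi)) phi) (lower_star (yoneda X)).
Proof.
rewrite -{2}(dist_yoneda_factor phi) dist_compA.
rewrite -[X in dist_le _ X]dist_comp1l.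
exact/dist_comp_monol/lower_upper_counit.
Qed.

End DistAlgebra.

Theorem corollary4p2 (Q : quantaloid) (T : two_functor Q) (That : lax_extension T)
  (hflat : flat That) :
  forall (X Y : qcat Q) (phi : qdist X Y), That X Y phi = Tbar T phi.
Proof.
move=> X Y phi; rewrite /Tbar; set Tf := tf_map T (transpose phi).
have [lower_y _] := hflat _ _ (yoneda X).
have [_ upper_f] := hflat _ _ (transpose phi).
apply: dist_le_antisym; last first.
  (* Only the [phi] under [That] on the right is factored; the one inside [transpose phi] must
     stay. *)
  rewrite lower_y upper_f -{2}(dist_yoneda_factor phi); exact: lax_comp.
apply: (@dist_le_trans _ _ _
  (dist_comp (upper_star Tf) (dist_comp (lower_star Tf) (That X Y phi)))).
  rewrite dist_compA -{1}[That X Y phi]dist_comp1l.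
  exact/dist_comp_monol/lower_upper_unit.
apply: dist_comp_monor; rewrite lower_y.
apply: dist_le_trans (dist_comp_monol _ (lax_lower That (transpose phi))) _.
exact: dist_le_trans (lax_comp That _ _) (lax_mono That (transpose_lower_le phi)).
Qed.
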